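(* Let $G\colon\mathbf{Set}\to\mathbf{Set}$ be a functor and let $(\alpha,\mathbb M)$ be a depth-1 graded semantics for $G$ such that the functor $\overline{M}_1\colon \mathrm{Alg}_0(\mathbb M)\to\mathrm{Alg}_0(\mathbb M)$ preserves monomorphisms. Let $(X,\gamma)$ be a $G$-coalgebra. Then for every $n\in\omega$ and every $(s,t)\in M_0X\times M_0X$, Duplicator has a winning strategy in the $n$-round game $\mathcal G_n(\gamma)$ from the initial configuration $(s,t)$ if and only if $(\gamma^{(n)})^*_0(s)=(\gamma^{(n)})^*_0(t)$.
   Context: A graded monad $\mathbb M$ on $\mathbf{Set}$ consists of functors $M_n\colon\mathbf{Set}\to\mathbf{Set}$ ($n\in\omega$), a natural transformation $\eta\colon\mathrm{Id}\to M_0$ and natural transformations $\mu^{n,k}\colon M_nM_k\to M_{n+k}$ such that $\mu^{n,0}\cdot M_n\eta=\mathrm{id}=\mu^{0,n}\cdot\eta M_n$ and $\mu^{n+k,m}\cdot\mu^{n,k}M_m=\mu^{n,k+m}\cdot M_n\mu^{k,m}$; then $(M_0,\eta,\mu^{0,0})$ is a monad. For $f\colon X\to M_kY$ the graded Kleisli star is $f^*_n:=\mu^{n,k}_Y\cdot M_nf\colon M_nX\to M_{n+k}Y$. A graded signature consists of operations with finite arity and a depth in $\omega$; terms of uniform depth $n$ over variables $X$ are defined inductively (variables have depth 0; $f(t_1,\dots,t_{\mathrm{ar}(f)})$ with all $t_i$ of uniform depth $k$ has depth $k+d(f)$); a graded theory is a set of equations between terms of the same uniform depth, and it induces a graded monad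 with $M_nX$ = depth-$n$ terms over $X$ modulo derivable equality (standard equational logic with substitution of axioms by uniform-depth substitutions), $\eta$ = inclusion of variables, $\mu$ = flattening. $\mathbb M$ is depth-1 if it is isomorphic to the graded monad induced by a graded theory all of whose operations and equations have depth at most 1. $\mathrm{Alg}_0(\mathbb M)$ is the category of Eilenberg–Moore algebras of the monad $M_0$. Each $M_kX$ is an $M_0$-algebra with structure $\mu^{0,k}_X$. For an $M_0$-algebra $(A,a)$, $\overline M_1(A,a)$ is the coequalizer in $\mathrm{Alg}_0(\mathbb M)$ of the two homomorphisms $\mu^{1,0}_A,\ M_1a\colon (M_1M_0A,\mu^{0,1}_{M_0A})\to(M_1A,\mu^{0,1}_A)$; on a homomorphism $h$, $\overline M_1h$ is the map induced by $M_1h$. For depth-1 $\mathbb M$ one has $\overline M_1(M_kX,\mu^{0,k}_X)=(M_{k+1}X,\mu^{0,k+1}_X)$ (with coequalizing map $\mu^{1,k}_X$). A depth-1 graded semantics for $G$ is a pair $(\alpha,\mathbb M)$ with $\mathbb M$ a depth-1 graded monad and $\alpha\colon G\to M_1$ a natural transformation. For a $G$-coalgebra $\gamma\colon X\to GX$ define $\gamma^{(0)}=M_0!\cdot\eta_X\colon X\to M_01$ and $\gamma^{(n+1)}=\mu^{1,n}_1\cdot M_1\gamma^{(n)}\cdot\alpha_X\cdot\gamma\colon X\to M_{n+1}1$. The game $\mathcal G_n(\gamma)$: for a relation $Z\subseteq M_0X\times M_0X$ with projections $\ell,r\colon Z\to M_0X$, let $c_Z\colon M_0X\to C_Z$ be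 the coequalizer in $\mathrm{Alg}_0(\mathbb M)$ of $\ell^*_0,r^*_0\colon M_0Z\to M_0X$, and put $\overline Z:=\overline M_1c_Z\cdot(\alpha_X\cdot\gamma)^*_0\colon M_0X\to M_1X=\overline M_1M_0X\to\overline M_1C_Z$. Configurations are pairs $(s,t)\in M_0X\times M_0X$. Each round from $(s,t)$: Duplicator chooses a relation $Z\subseteq M_0X\times M_0X$ with $\overline Z(s)=\overline Z(t)$; then Spoiler picks $(s',t')\in Z$, the next configuration. A player who cannot move loses. After $n$ rounds, ending in $(s_n,t_n)$, Duplicator wins iff $M_0!(s_n)=M_0!(t_n)$ (so for $n=0$ Duplicator wins iff $M_0!(s)=M_0!(t)$). *)

(* Defs.v *)
From mathcomp Require Import all_boot.
From mathcomp Require Import boolp.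

Set Implicit Arguments.
Unset Strict Implicit.
Unset Printing Implicit Defensive.

Local Open Scope quotient_scope.

(* The category Set is rendered by the types of one fixed universe; naming that
   universe keeps functors composable. *)
Definition Sets := Type.

Section Quotient.
Variables (T : Sets) (R : T -> T -> Prop).
Hypothesis R_refl : forall x, R x x.
Hypothesis R_sym : forall x y, R x y -> R y x.
Hypothesis R_trans : forall x y z, R x y -> R y z -> R x z.

Let rb : rel {classic T} := fun x y => `[< R x y >].

Fact quot_refl : reflexive rb.
Proof. by move=> x; apply/asboolP; exact: R_refl. Qed.

Fact quot_sym : symmetric rb.
Proof. by move=> x y; apply/asboolP/asboolP; exact: R_sym. Qed.

Fact quot_trans : transitive rb.
Proof.
by move=> y x z /asboolP xy /asboolP yz; apply/asboolP; exact: R_trans xy yz.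
Qed.

Definition quot_equiv : equiv_rel {classic T} :=
  EquivRel rb quot_refl quot_sym quot_trans.

Definition quot : Sets := {eq_quot quot_equiv}.

Definition quot_class (x : T) : quot :=
  \pi_{eq_quot quot_equiv} (x : {classic T}).

Definition quot_repr (q : quot) : T := repr (q : {eq_quot quot_equiv}).

Lemma quot_reprK q : quot_class (quot_repr q) = q.
Proof. exact: reprK. Qed.

Lemma quot_eqP x y : quot_class x = quot_class y <-> R x y.
Proof.
split; first by move/eqquotP/asboolP.
by move=> Rxy; apply/eqquotP/asboolP.
Qed.

End Quotient.

Record functor := Functor {
  fobj :> Sets -> Sets;
  fmap : forall X Y : Sets, (X -> Y) -> fobj X -> fobj Y;
  fmap_id : forall (X : Sets) (t : fobj X), fmap id t = t;
  fmap_comp : forall (X Y Z : Sets) (g : Y -> Z) (f : X -> Y) (t : fobj X),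
    fmap (g \o f) t = fmap g (fmap f t) }.

Arguments fmap f {X Y} _ _ : rename.

Definition natural (F G : functor) (a : forall X : Sets, F X -> G X) : Prop :=
  forall (X Y : Sets) (f : X -> Y) (t : F X),
    a Y (fmap F f t) = fmap G f (a X t).

(* The laws compare elements of M_(n + 0) and M_n, resp. of M_((n + k) + m) and
   M_(n + (k + m)); [ecast] transports along the equality of the grades. *)
Record graded_monad := GradedMonad {
  gm :> nat -> functor;
  eta : forall X : Sets, X -> gm 0 X;
  mu : forall (n k : nat) (X : Sets), gm n (gm k X) -> gm (n + k) X;
  eta_natural : forall (X Y : Sets) (f : X -> Y) (x : X),
    eta (f x) = fmap (gm 0) f (eta x);
  mu_natural : forall n k (X Y : Sets) (f : X -> Y) (t : gm n (gm k X)),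
    mu (fmap (gm n) (fmap (gm k) f) t) = fmap (gm (n + k)) f (mu t);
  mu_fmap_eta : forall n (X : Sets) (t : gm n X),
    ecast i (gm i X) (addn0 n) (mu (fmap (gm n) (@eta X) t)) = t;
  mu_eta : forall n (X : Sets) (t : gm n X), mu (eta t) = t;
  mu_assoc : forall n k m (X : Sets) (t : gm n (gm k (gm m X))),
    ecast i (gm i X) (addnA n k m) (mu (fmap (gm n) (@mu k m X) t)) =
    mu (mu t) }.

Arguments eta M {X} _ : rename.
Arguments mu M n k {X} _ : rename.

Definition star (M : graded_monad) (n k : nat) (X Y : Sets) (f : X -> M k Y)
  (t : M n X) : M (n + k) Y := mu M n k (fmap (M n) f t).

(* An isomorphism of graded monads: a family of natural bijections compatible
   with unit and multiplication. *)
Definition gm_iso (M N : graded_monad) : Prop :=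
  exists phi : forall (n : nat) (X : Sets), M n X -> N n X,
    [/\ forall n, natural (@phi n),
        forall n X, bijective (@phi n X),
        forall (X : Sets) (x : X), phi 0 X (eta M x) = eta N x
      & forall n k (X : Sets) (t : M n (M k X)),
          phi (n + k) X (mu M n k t) =
          mu N n k (phi n (N k X) (fmap (M n) (phi k X) t))].

Record graded_signature := GradedSignature {
  op : Sets;
  arity : op -> nat;
  depth : op -> nat }.

Section Terms.
Variable S : graded_signature.

Inductive term (X : Sets) : Sets :=
| Var of X
| App (f : op S) of ('I_(arity f) -> term X).

(* [uniform t n]: t has uniform depth n. The premise on arguments is vacuous for
   a constant c, which therefore has uniform depth n for every n >= depth c. *)
Inductive uniform (X : Sets) : term X -> nat -> Prop :=
| uniform_var x : uniform (Var x) 0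
| uniform_app f ts k :
    (forall i, uniform (ts i) k) -> uniform (@App X f ts) (k + depth f).

Fixpoint subst (X Y : Sets) (s : X -> term Y) (t : term X) : term Y :=
  match t with
  | Var x => s x
  | App f ts => App (fun i => subst s (ts i))
  end.

(* Each equation carries its own finite set of variables. *)
Record equation := Equation {
  eq_vars : nat;
  eq_depth : nat;
  lhs : term 'I_eq_vars;
  rhs : term 'I_eq_vars;
  lhs_uniform : uniform lhs eq_depth;
  rhs_uniform : uniform rhs eq_depth }.

End Terms.

Arguments Var {S X} _.
Arguments App {S X} f _.

Record graded_theory := GradedTheory {
  sig :> graded_signature;
  axioms : equation sig -> Prop }.

Inductive derivable (T : graded_theory) (X : Sets) :
    nat -> term T X -> term T X -> Prop :=
| derivable_refl n t : uniform t n -> derivable n t t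
| derivable_sym n s t : derivable n s t -> derivable n t s
| derivable_trans n s t u :
    derivable n s t -> derivable n t u -> derivable n s u
| derivable_app f ss ts k :
    (forall i, derivable k (ss i) (ts i)) ->
    derivable (k + depth f) (App f ss) (App f ts)
| derivable_axiom (e : equation T) k (s : 'I_(eq_vars e) -> term T X) :
    axioms e -> (forall v, uniform (s v) k) ->
    derivable (eq_depth e + k) (subst s (lhs e)) (subst s (rhs e)).

Section TermLemmas.
Variable T : graded_theory.

Lemma subst_var (X : Sets) (t : term T X) : subst Var t = t.
Proof. by elim: t => //= f ts IH; congr App; apply/funext => i; exact: IH. Qed.

Lemma subst_subst (X Y Z : Sets) (s : X -> term T Y) (r : Y -> term T Z) t :
  subst r (subst s t) = subst (fun x => subst r (s x)) t.
Proof. by elim: t => //= f ts IH; congr App; apply/funext => i; exact: IH. Qed.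

Lemma uniform_subst (X Y : Sets) (s : X -> term T Y) n k t :
  uniform t n -> (forall x, uniform (s x) k) -> uniform (subst s t) (n + k).
Proof.
move=> ut us; elim: ut => [x|f ts j _ IH] /=; first exact: us.
by rewrite addnAC; exact: uniform_app.
Qed.

Lemma uniform_rename (X Y : Sets) (f : X -> Y) n (t : term T X) :
  uniform t n -> uniform (subst (fun x => Var (f x)) t) n.
Proof.
by move=> ut; rewrite -[n]addn0; apply: uniform_subst => // x; constructor.
Qed.

Lemma derivable_substl (X Y : Sets) (s : X -> term T Y) n k t u :
  derivable n t u -> (forall x, uniform (s x) k) ->
  derivable (n + k) (subst s t) (subst s u).
Proof.
move=> tu us; elim: tu => {n t u}.
- by move=> n t ut; constructor; exact: uniform_subst.
- by move=> n t u _; exact: derivable_sym.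
- by move=> n t u v _ + _; exact: derivable_trans.
- by move=> f ss ts j _ IH /=; rewrite addnAC; exact: derivable_app.
- move=> e j r ax ur; rewrite !subst_subst -addnA.
  by apply: derivable_axiom => // v; exact: uniform_subst.
Qed.

Lemma derivable_substr (X Y : Sets) (s r : X -> term T Y) n k t :
  uniform t n -> (forall x, derivable k (s x) (r x)) ->
  derivable (n + k) (subst s t) (subst r t).
Proof.
move=> ut sr; elim: ut => [x|f ts j _ IH] /=; first exact: sr.
by rewrite addnAC; exact: derivable_app.
Qed.

Lemma derivable_rename (X Y : Sets) (f : X -> Y) n (t u : term T X) :
  derivable n t u ->
  derivable n (subst (fun x => Var (f x)) t) (subst (fun x => Var (f x)) u).
Proof.
move=> tu; rewrite -[n]addn0; apply: derivable_substl => // x.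
exact: uniform_var.
Qed.

Lemma derivable_var (X : Sets) (s : X -> term T X) n (t : term T X) :
  uniform t n -> (forall x, derivable 0 (s x) (Var x)) ->
  derivable n (subst s t) t.
Proof.
move=> ut sv; rewrite -[X in derivable _ _ X]subst_var -[n]addn0.
exact: derivable_substr.
Qed.

End TermLemmas.

Section InducedMonad.
Variable T : graded_theory.
Implicit Types X Y Z : Sets.

Definition uterm n X : Sets := {t : term T X | uniform t n}.

Definition ueq n X (s t : uterm n X) : Prop := derivable n (sval s) (sval t).

Fact ueq_refl n X (t : uterm n X) : ueq t t.
Proof. by apply: derivable_refl; exact: (svalP t). Qed.

Fact ueq_sym n X (s t : uterm n X) : ueq s t -> ueq t s.
Proof. exact: derivable_sym. Qed.

Fact ueq_trans n X (s t u : uterm n X) : ueq s t -> ueq t u -> ueq s u.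
Proof. exact: derivable_trans. Qed.

Definition im_obj n X : Sets :=
  quot (@ueq_refl n X) (@ueq_sym n X) (@ueq_trans n X).

Definition im_class n X (t : term T X) (ut : uniform t n) : im_obj n X :=
  quot_class _ _ _ (exist (fun t => uniform t n) t ut).

Definition im_repr n X (q : im_obj n X) : term T X := sval (quot_repr q).

Lemma im_repr_uniform n X (q : im_obj n X) : uniform (im_repr q) n.
Proof. exact: (svalP (quot_repr q)). Qed.

Lemma im_classP n X (s t : term T X) (us : uniform s n) (ut : uniform t n) :
  im_class us = im_class ut <-> derivable n s t.
Proof. by rewrite /im_class quot_eqP. Qed.

Lemma im_reprK n X (q : im_obj n X) : im_class (im_repr_uniform q) = q.
Proof.
rewrite -[RHS]quot_reprK; apply/quot_eqP.
by apply: derivable_refl; exact: im_repr_uniform.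
Qed.

Lemma im_repr_class n X (t : term T X) (ut : uniform t n) :
  derivable n (im_repr (im_class ut)) t.
Proof. by apply/(im_classP (im_repr_uniform _) ut); rewrite im_reprK. Qed.

Lemma im_ecast n m X (e : n = m) (t : term T X) (ut : uniform t n) :
  ecast i (im_obj i X) e (im_class ut) =
  im_class (ecast i (uniform t i) e ut).
Proof. by case: m / e. Qed.

Definition im_map n X Y (f : X -> Y) (q : im_obj n X) : im_obj n Y :=
  im_class (uniform_rename f (im_repr_uniform q)).

Lemma im_map_class n X Y (f : X -> Y) (t : term T X) (ut : uniform t n) :
  im_map f (im_class ut) = im_class (uniform_rename f ut).
Proof.
by apply/im_classP/derivable_rename; exact: im_repr_class.
Qed.

Fact im_map_id n X (q : im_obj n X) : im_map id q = q.
Proof.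
rewrite -[RHS]im_reprK; apply/im_classP; rewrite subst_var.
by apply: derivable_refl; exact: im_repr_uniform.
Qed.

Fact im_map_comp n X Y Z (g : Y -> Z) (f : X -> Y) (q : im_obj n X) :
  im_map (g \o f) q = im_map g (im_map f q).
Proof.
rewrite [im_map f q]/im_map im_map_class; apply/im_classP; rewrite subst_subst.
by apply: derivable_refl; apply: uniform_rename; exact: im_repr_uniform.
Qed.

Definition im n : functor := Functor (@im_map_id n) (@im_map_comp n).

Definition im_eta X (x : X) : im 0 X := im_class (uniform_var T x).

(* Flattening. *)
Definition im_mu n k X (q : im n (im k X)) : im (n + k) X :=
  im_class (uniform_subst (im_repr_uniform q) (@im_repr_uniform k X)).

Lemma im_mu_class n k X (t : term T (im k X)) (ut : uniform t n) :
  im_mu (im_class ut) =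
  im_class (uniform_subst ut (@im_repr_uniform k X)).
Proof.
apply/im_classP; apply: derivable_substl; first exact: im_repr_class.
exact: im_repr_uniform.
Qed.

Fact im_eta_natural X Y (f : X -> Y) (x : X) :
  im_eta (f x) = fmap (im 0) f (im_eta x).
Proof.
rewrite /= /im_eta im_map_class; apply/im_classP.
by apply: derivable_refl; exact: uniform_var.
Qed.

Fact im_mu_natural n k X Y (f : X -> Y) (q : im n (im k X)) :
  im_mu (fmap (im n) (fmap (im k) f) q) = fmap (im (n + k)) f (im_mu q).
Proof.
rewrite /= {1}/im_map im_mu_class [im_mu q]/im_mu im_map_class.
apply/im_classP; rewrite !subst_subst.
apply: derivable_substr; first exact: im_repr_uniform.
by move=> x; exact: im_repr_class.
Qed.

Fact im_mu_fmap_eta n X (q : im n X) :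
  ecast i (im i X) (addn0 n) (im_mu (fmap (im n) (@im_eta X) q)) = q.
Proof.
rewrite /= /im_map im_mu_class im_ecast -[RHS]im_reprK; apply/im_classP.
rewrite subst_subst; apply: derivable_var; first exact: im_repr_uniform.
by move=> x; exact: im_repr_class.
Qed.

Fact im_mu_eta n X (q : im n X) : im_mu (im_eta q) = q.
Proof.
rewrite /im_eta im_mu_class -[RHS]im_reprK; apply/im_classP.
by apply: derivable_refl; exact: im_repr_uniform.
Qed.

Fact im_mu_assoc n k m X (q : im n (im k (im m X))) :
  ecast i (im i X) (addnA n k m) (im_mu (fmap (im n) (@im_mu k m X) q)) =
  im_mu (im_mu q).
Proof.
rewrite /= /im_map im_mu_class im_ecast [im_mu q]/im_mu im_mu_class.
apply/im_classP; rewrite !subst_subst -addnA.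
apply: derivable_substr; first exact: im_repr_uniform.
by move=> x; exact: im_repr_class.
Qed.

Definition induced_monad : graded_monad :=
  GradedMonad im_eta_natural im_mu_natural im_mu_fmap_eta im_mu_eta im_mu_assoc.

End InducedMonad.

Definition depth1_theory (T : graded_theory) : Prop :=
  (forall f : op T, depth f <= 1) /\
  (forall e : equation T, axioms e -> eq_depth e <= 1).

Definition depth1 (M : graded_monad) : Prop :=
  exists2 T : graded_theory, depth1_theory T & gm_iso M (induced_monad T).

Record graded_semantics (G : functor) := GradedSemantics {
  gs_monad :> graded_monad;
  gs_depth1 : depth1 gs_monad;
  gs_alpha : forall X : Sets, G X -> gs_monad 1 X;
  gs_alpha_natural : natural gs_alpha }.

Arguments gs_alpha {G} _ {X} _.

(* Grades such as 0 + k and 1 + 0 reduce, so no transport is needed below. *)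
Section Algebras.
Variable M : graded_monad.

Record alg := Alg {
  carrier :> Type;
  act : M 0 carrier -> carrier;
  act_eta : forall x, act (eta M x) = x;
  act_mu : forall t : M 0 (M 0 carrier),
    act (mu M 0 0 t) = act (fmap (M 0) act t) }.

Record hom (A B : alg) := Hom {
  hom_fun :> A -> B;
  hom_act : forall t : M 0 A, hom_fun (act t) = act (fmap (M 0) hom_fun t) }.

Definition mono (A B : alg) (m : hom A B) : Prop :=
  forall (C : alg) (u v : hom C A), m \o u =1 m \o v -> u =1 v.

Lemma gm_assoc0 n m (X : Sets) (t : M 0 (M n (M m X))) :
  mu M n m (mu M 0 n t) = mu M 0 (n + m) (fmap (M 0) (mu M n m) t).
Proof. by have := mu_assoc t; rewrite eq_axiomK => <-. Qed.

Lemma mu00_natural (X Y : Sets) (f : X -> Y) (t : M 0 (M 0 X)) :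
  fmap (M 0) f (mu M 0 0 t) = mu M 0 0 (fmap (M 0) (fmap (M 0) f) t).
Proof. by rewrite mu_natural. Qed.

Lemma mu10_natural (X Y : Sets) (f : X -> Y) (t : M 1 (M 0 X)) :
  fmap (M 1) f (mu M 1 0 t) = mu M 1 0 (fmap (M 1) (fmap (M 0) f) t).
Proof. by rewrite mu_natural. Qed.

Fact hom_comp_act (A B C : alg) (g : hom B C) (f : hom A B) (t : M 0 A) :
  (g \o f) (act t) = act (fmap (M 0) (g \o f) t).
Proof. by rewrite /= !hom_act fmap_comp. Qed.

Definition hom_comp (A B C : alg) (g : hom B C) (f : hom A B) : hom A C :=
  Hom (hom_comp_act g f).

Definition gm_alg (k : nat) (X : Sets) : alg :=
  @Alg (M k X) (mu M 0 k) (@mu_eta M k X) (@gm_assoc0 0 k X).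

Fact star0_act k (X Y : Sets) (f : X -> M k Y) (t : M 0 (gm_alg 0 X)) :
  star f (act t) = act (fmap (M 0) (star f) t : M 0 (gm_alg k Y)).
Proof.
have -> : star f (act t) = mu M 0 k (mu M 0 0 (fmap (M 0) (fmap (M 0) f) t)).
  by rewrite mu_natural.
by rewrite gm_assoc0 -fmap_comp.
Qed.

Definition star0 k (X Y : Sets) (f : X -> M k Y) :
  hom (gm_alg 0 X) (gm_alg k Y) := 
  @Hom (gm_alg 0 X) (gm_alg k Y) (star f) (star0_act f).

End Algebras.

Section Coequalizer.
Variables (M : graded_monad) (A B : alg M) (f g : hom A B).

Definition coeq_rel (x y : B) : Prop :=
  forall (C : alg M) (h : hom B C), h \o f =1 h \o g -> h x = h y.

Fact coeq_rel_refl x : coeq_rel x x. Proof. by []. Qed.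

Fact coeq_rel_sym x y : coeq_rel x y -> coeq_rel y x.
Proof. by move=> xy C h hfg; rewrite (xy C h). Qed.

Fact coeq_rel_trans x y z : coeq_rel x y -> coeq_rel y z -> coeq_rel x z.
Proof. by move=> xy yz C h hfg; rewrite (xy C h) // (yz C h). Qed.

Definition coeq_obj : Sets := quot coeq_rel_refl coeq_rel_sym coeq_rel_trans.

Definition coeq_class : B -> coeq_obj := @quot_class B coeq_rel _ _ _.

Definition coeq_repr : coeq_obj -> B := @quot_repr B coeq_rel _ _ _.

Lemma coeq_reprK q : coeq_class (coeq_repr q) = q.
Proof. exact: quot_reprK. Qed.

Lemma coeq_classP x y : coeq_class x = coeq_class y <-> coeq_rel x y.
Proof. exact: quot_eqP. Qed.

Lemma coeq_repr_class x : coeq_rel (coeq_repr (coeq_class x)) x.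
Proof. by apply/coeq_classP; rewrite coeq_reprK. Qed.

Definition coeq_act (t : M 0 coeq_obj) : coeq_obj :=
  coeq_class (act (fmap (M 0) coeq_repr t)).

Lemma coeq_class_act (t : M 0 B) :
  coeq_class (act t) = coeq_act (fmap (M 0) coeq_class t).
Proof.
apply/coeq_classP => C h hfg; rewrite !hom_act -!fmap_comp.
by congr (act (fmap _ _ _)); apply/funext => x; apply/esym/coeq_repr_class.
Qed.

Fact coeq_act_eta q : coeq_act (eta M q) = q.
Proof. by rewrite /coeq_act -eta_natural act_eta coeq_reprK. Qed.

Fact coeq_act_mu (t : M 0 (M 0 coeq_obj)) :
  coeq_act (mu M 0 0 t) = coeq_act (fmap (M 0) coeq_act t).
Proof.
rewrite {1}/coeq_act mu00_natural act_mu -fmap_comp coeq_class_act -fmap_comp.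
by [].
Qed.

Definition coeq : alg M := Alg coeq_act_eta coeq_act_mu.

Definition coeq_map : hom B coeq := @Hom M B coeq coeq_class coeq_class_act.

Lemma coeq_mapE : coeq_map \o f =1 coeq_map \o g.
Proof. by move=> x; apply/coeq_classP => C h; apply. Qed.

Section Universal.
Variables (C : alg M) (h : hom B C).
Hypothesis hfg : h \o f =1 h \o g.

Fact coeq_desc_act (t : M 0 coeq) :
  (h \o coeq_repr) (act t) = act (fmap (M 0) (h \o coeq_repr) t).
Proof.
by rewrite /= (coeq_repr_class _ hfg) hom_act fmap_comp.
Qed.

Definition coeq_desc : hom coeq C := Hom coeq_desc_act.

Lemma coeq_descE : coeq_desc \o coeq_map =1 h.
Proof. by move=> x; exact: coeq_repr_class. Qed.

Lemma coeq_desc_unique (k : hom coeq C) :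
  k \o coeq_map =1 h -> k =1 coeq_desc.
Proof.
move=> kh q; rewrite -[q]coeq_reprK.
exact: etrans (kh _) (esym (coeq_descE _)).
Qed.

End Universal.
End Coequalizer.

Section Mbar1.
Variable M : graded_monad.

Fact fmap1_act (X Y : Sets) (f : X -> Y) (t : M 0 (gm_alg M 1 X)) :
  fmap (M 1) f (act t) = act (fmap (M 0) (fmap (M 1) f) t : M 0 (gm_alg M 1 Y)).
Proof. by rewrite /= mu_natural. Qed.

Definition fmap1 (X Y : Sets) (f : X -> Y) :
  hom (gm_alg M 1 X) (gm_alg M 1 Y) :=
  @Hom M (gm_alg M 1 X) (gm_alg M 1 Y) (fmap (M 1) f) (fmap1_act f).

Fact mu10_act (X : Sets) (t : M 0 (gm_alg M 1 (M 0 X))) :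
  mu M 1 0 (act t) = act (fmap (M 0) (mu M 1 0) t : M 0 (gm_alg M 1 X)).
Proof. exact: gm_assoc0. Qed.

Definition mu10 (X : Sets) : hom (gm_alg M 1 (M 0 X)) (gm_alg M 1 X) :=
  @Hom M (gm_alg M 1 (M 0 X)) (gm_alg M 1 X) (mu M 1 0) (@mu10_act X).

Definition Mbar1 (A : alg M) : alg M := coeq (mu10 A) (fmap1 (@act M A)).

Definition Mbar1_quo (A : alg M) : hom (gm_alg M 1 A) (Mbar1 A) :=
  coeq_map (mu10 A) (fmap1 (@act M A)).

Fact Mbar1_map_subproof (A B : alg M) (h : hom A B) :
  hom_comp (Mbar1_quo B) (fmap1 h) \o mu10 A =1
  hom_comp (Mbar1_quo B) (fmap1 h) \o fmap1 (@act M A).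
Proof.
move=> t /=; rewrite mu10_natural -fmap_comp.
rewrite (_ : h \o act (a:=A) = act (a:=B) \o fmap (M 0) h).
  by rewrite fmap_comp; exact: (coeq_mapE (mu10 B) (fmap1 (@act M B))).
by apply/funext => x; exact: hom_act.
Qed.

Definition Mbar1_map (A B : alg M) (h : hom A B) : hom (Mbar1 A) (Mbar1 B) :=
  coeq_desc (@Mbar1_map_subproof A B h).

Lemma Mbar1_mapE (A B : alg M) (h : hom A B) :
  Mbar1_map h \o Mbar1_quo A =1 Mbar1_quo B \o fmap (M 1) h.
Proof. exact: coeq_descE. Qed.

Lemma Mbar1_map_id (A : alg M) (h : hom A A) : h =1 id -> Mbar1_map h =1 id.
Proof.
move=> h1 q; rewrite -[q]coeq_reprK [LHS]Mbar1_mapE /=.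
by rewrite (_ : hom_fun h = id) ?fmap_id //; apply/funext.
Qed.

Lemma Mbar1_map_comp (A B C : alg M) (g : hom B C) (f : hom A B) :
  Mbar1_map (hom_comp g f) =1 Mbar1_map g \o Mbar1_map f.
Proof.
move=> q; rewrite -[q]coeq_reprK [LHS]Mbar1_mapE /=.
rewrite fmap_comp; apply/esym.
exact: etrans (congr1 (Mbar1_map g) (Mbar1_mapE f _)) (Mbar1_mapE g _).
Qed.

(* The identification of M_1 X with the chosen coequalizer Mbar1 (M_0 X): the
   comparison map of the two coequalizers, as [Mbar1_free_mu] and
   [Mbar1_free_bij] show. *)
Definition Mbar1_free (X : Sets) (t : M 1 X) : Mbar1 (gm_alg M 0 X) :=
  Mbar1_quo (gm_alg M 0 X) (fmap (M 1) (@eta M X) t).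

Lemma Mbar1_free_mu (X : Sets) (t : M 1 (M 0 X)) :
  Mbar1_free (mu M 1 0 t) = Mbar1_quo (gm_alg M 0 X) t.
Proof.
rewrite /Mbar1_free mu10_natural.
rewrite [LHS](coeq_mapE (mu10 _) (fmap1 (@act M (gm_alg M 0 X)))) /=.
congr (coeq_class _ _ _); rewrite -fmap_comp -[RHS]fmap_id.
congr (fmap _ _ _); apply/funext => x /=.
by have := mu_fmap_eta x; rewrite eq_axiomK.
Qed.

Lemma mu10_coeq (X : Sets) :
  mu10 X \o mu10 (gm_alg M 0 X) =1 mu10 X \o fmap1 (@act M (gm_alg M 0 X)).
Proof. by move=> t /=; have := mu_assoc t; rewrite eq_axiomK => <-. Qed.

Lemma Mbar1_free_bij (X : Sets) : bijective (@Mbar1_free X).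
Proof.
exists (coeq_desc (@mu10_coeq X)) => [t|q].
  rewrite /Mbar1_free [LHS](coeq_descE (@mu10_coeq X)) /=.
  by have := mu_fmap_eta t; rewrite eq_axiomK.
rewrite -[q]coeq_reprK [coeq_desc _ _](coeq_descE (@mu10_coeq X)).
exact: Mbar1_free_mu.
Qed.

Definition Mbar1_preserves_mono : Prop :=
  forall (A B : alg M) (m : hom A B), mono m -> mono (Mbar1_map m).

End Mbar1.

Section Game.
Variables (G : functor) (S : graded_semantics G) (X : Sets) (gamma : X -> G X).

Fixpoint gamma_iter (n : nat) : X -> S n unit :=
  match n return X -> S n unit with
  | 0 => fun x => fmap (S 0) (fun=> tt) (eta S x)
  | k.+1 => fun x =>
      mu S 1 k (fmap (S 1) (gamma_iter k) (gs_alpha S (gamma x)))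
  end.

Definition config : Sets := (S 0 X * S 0 X)%type.

Definition config_rel := config -> Prop.

Section Step.
Variable Z : config_rel.

Definition ellZ (p : {c : config | Z c}) : S 0 X := (sval p).1.
Definition rZ (p : {c : config | Z c}) : S 0 X := (sval p).2.

Definition CZ : alg S := coeq (star0 ellZ) (star0 rZ).

Definition cZ : hom (gm_alg S 0 X) CZ := coeq_map (star0 ellZ) (star0 rZ).

Definition Zbar (s : S 0 X) : Mbar1 CZ :=
  Mbar1_map cZ
    (Mbar1_free (star (n := 0) (fun x => gs_alpha S (gamma x)) s)).

End Step.

(* A strategy for Duplicator: the relation to play, given the list of previous
   configurations and the current one. *)
Definition strategy := seq config -> config -> config_rel.

(* [play sigma c0 h c]: the configuration c, with h the list of configurations
   before it, is reached after [size h] rounds from c0 by some play in which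
   Duplicator follows sigma. *)
Inductive play (sigma : strategy) (c0 : config) :
    seq config -> config -> Prop :=
| play_start : play sigma c0 [::] c0
| play_round h c c' :
    play sigma c0 h c -> sigma h c c' -> play sigma c0 (rcons h c) c'.

Definition admissible (Z : config_rel) (c : config) : Prop :=
  Zbar Z c.1 = Zbar Z c.2.

Definition final_win (c : config) : Prop :=
  fmap (S 0) (fun=> tt) c.1 = fmap (S 0) (fun=> tt) c.2.

(* A play in which Spoiler gets stuck before round n has no further
   continuation, so it counts as won by Duplicator. *)
Definition winning (n : nat) (c0 : config) (sigma : strategy) : Prop :=
  forall h c, play sigma c0 h c ->
    (size h < n -> admissible (sigma h c) c) /\ (size h = n -> final_win c).

Definition duplicator_wins (n : nat) (c0 : config) : Prop :=
  exists sigma, winning n c0 sigma.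

End Game.

Arguments gamma_iter {G} S {X} gamma n _.
Arguments duplicator_wins {G} S {X} gamma n c0.

(* Main.v *)
(* Write g for the Kleisli extension of gamma^(n). As M is depth-1, mu^{1,n}
   identifies Mbar1 (M_n 1) with M_(n+1) 1, so equality under gamma^(n+1) is
   equality under Mbar1 g after one step. If all pairs of Z agree under g, then
   g factors through c_Z, so that states with equal Zbar agree under
   gamma^(n+1). Conversely, for Z the kernel of g the factorization C_Z -> M_n 1
   is injective, hence so is its image under Mbar1, and Z is an admissible move:
   Duplicator always plays the kernel for the remaining number of rounds.
   The injectivity half of the identification holds because a term of depth n+1
   over depth-1 operations is determined by its layers: any homomorphism h out
   of M_1 M_n X that coequalizes mu^{1,0} and M_1 mu^{0,n} interprets terms of
   depth n+1, and depth-1 equations are sound for this interpretation. *)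
From mathcomp Require Import all_boot.
From mathcomp Require Import boolp.
Require Import Defs.

Set Implicit Arguments.
Unset Strict Implicit.
Unset Printing Implicit Defensive.

(** * Uniform depth and derivability of terms *)

Lemma uniform_inv (T : graded_signature) (X : Sets) (t : term T X) n :
  uniform t n ->
  match t with
  | Var _ => n = 0
  | App f ts => exists2 k, n = k + depth f & forall i, uniform (ts i) k
  end.
Proof. by case=> // f ts k us; exists k. Qed.

Lemma uniform_op (T : graded_signature) (X : Sets) (f : op T)
  (xs : 'I_(arity f) -> X) d :
  depth f = d -> uniform (App f (fun i => Var (xs i))) d.
Proof. by move=> <-; apply: (@uniform_app T X f _ 0) => i; constructor. Qed.

Lemma derivable_uniform (T : graded_theory) (X : Sets) n (t u : term T X) :
  derivable n t u -> uniform t n /\ uniform u n.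
Proof.
elim=> {n t u}.
- by [].
- by move=> n t u _ [].
- by move=> n t u v _ [? _] _ [].
- by move=> f ss ts k _ IH; split; apply: uniform_app => i; case: (IH i).
- move=> e k s _ us.
  by split; apply: uniform_subst => //; [exact: lhs_uniform|exact: rhs_uniform].
Qed.

Lemma derivable_ax (T : graded_theory) (e : equation T) :
  axioms e -> derivable (eq_depth e) (lhs e) (rhs e).
Proof.
move=> ax; rewrite -[lhs e]subst_var -[rhs e]subst_var -[eq_depth e]addn0.
by apply: derivable_axiom => // v; constructor.
Qed.

(** * Graded monads presented by graded theories *)

(** Hides the isomorphism with the induced monad and its choice of representatives; what follows
    handles only uniform terms and derivability. *)
Record presentation (M : graded_monad) (T : graded_theory) := Presentation {
  cls : forall n (X : Sets) (t : term T X), uniform t n -> M n X;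
  cls_surj : forall n (X : Sets) (x : M n X),
    exists t (ut : uniform t n), cls ut = x;
  cls_eqP : forall n (X : Sets) (t u : term T X)
    (ut : uniform t n) (uu : uniform u n), cls ut = cls uu <-> derivable n t u;
  cls_var : forall (X : Sets) (x : X), cls (uniform_var T x) = eta M x;
  cls_fmap : forall n (X Y : Sets) (f : X -> Y) (t : term T X)
    (ut : uniform t n), fmap (M n) f (cls ut) = cls (uniform_rename f ut);
  cls_mu : forall n k (X Y : Sets) (t : term T X) (s : X -> term T Y)
    (ut : uniform t n) (us : forall x, uniform (s x) k),
    mu M n k (fmap (M n) (fun x => cls (us x)) (cls ut)) =
    cls (uniform_subst ut us) }.

Lemma depth1_presentation (M : graded_monad) : depth1 M ->
  exists2 T, depth1_theory T & inhabited (presentation M T).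
Proof.
case=> T dT [phi [phi_nat phi_bij phi_eta phi_mu]]; exists T => //.
have psi_ex n X : exists g, cancel (phi n X) g /\ cancel g (phi n X).
  by case: (phi_bij n X) => g; exists g.
pose psi n X := projT1 (cid (psi_ex n X)).
have phiK n X : cancel (phi n X) (psi n X) by case: (projT2 (cid (psi_ex n X))).
have psiK n X : cancel (psi n X) (phi n X) by case: (projT2 (cid (psi_ex n X))).
constructor.
apply: (@Presentation M T (fun n X t ut => psi n X (im_class ut))).
- move=> n X x; exists (im_repr (phi n X x)), (im_repr_uniform (phi n X x)).
  by rewrite im_reprK phiK.
- move=> n X t u ut uu; rewrite -(im_classP ut uu).
  by split=> [/(can_inj (psiK n X))|->].
- by move=> X x; rewrite -[RHS]phiK phi_eta.
- move=> n X Y f t ut; rewrite -[LHS]phiK; congr (psi _ _ _).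
  by rewrite phi_nat psiK /= im_map_class.
- move=> n k X Y t s ut us; rewrite -[LHS]phiK; congr (psi _ _ _).
  rewrite phi_mu -fmap_comp phi_nat psiK /= im_map_class im_mu_class.
  apply/im_classP; rewrite subst_subst.
  apply: derivable_substr => // x /=.
  by rewrite psiK; exact: im_repr_class.
Qed.

Section Presentation.
Variables (M : graded_monad) (T : graded_theory) (P : presentation M T).

Lemma cls_ext k (Y : Sets) (t u : term T Y) (ut : uniform t k)
  (uu : uniform u k) : t = u -> cls P ut = cls P uu.
Proof. by move=> tu; apply/cls_eqP; rewrite tu; constructor; rewrite -tu. Qed.

(** The grade [d] is kept apart from [depth f] so that it can be a literal 0 or 1. *)
Definition cls_op (Y : Sets) (f : op T) (ys : 'I_(arity f) -> Y) d
  (e : depth f = d) : M d Y := cls P (uniform_op ys e).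

Lemma cls_op_fmap (Y Z : Sets) (g : Y -> Z) f (ys : 'I_(arity f) -> Y) d
  (e : depth f = d) :
  fmap (M d) g (cls_op ys e) = cls_op (fun i => g (ys i)) e.
Proof. by rewrite /cls_op cls_fmap; exact: cls_ext. Qed.

Lemma cls_app (Y : Sets) f (ts : 'I_(arity f) -> term T Y) d k
  (e : depth f = d) (us : forall i, uniform (ts i) k)
  (u : uniform (App f ts) (d + k)) :
  cls P u = mu M d k (cls_op (fun i => cls P (us i)) e).
Proof.
rewrite -(cls_op_fmap (fun i => cls P (us i)) id).
by rewrite /cls_op cls_mu; exact: cls_ext.
Qed.

End Presentation.

(** * Terms of depth [n.+1] read in an algebra *)

Section Interpretation.
Variables (M : graded_monad) (T : graded_theory) (P : presentation M T).
Hypothesis T_depth1 : depth1_theory T.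
Variables (n : nat) (X : Sets) (C : alg M).
Variable h : hom (gm_alg M 1 (M n X)) C.
Hypothesis h_coeq :
  h \o mu10 M (M n X) =1 h \o fmap1 M (@act M (gm_alg M n X)).
Variable c0 : C.

(* Reads a term of uniform depth [n.+1] as an element of [C]: the operations of
   depth 0 above the first layer of depth 1 act on [C], and that layer, applied
   to classes of terms of depth [n], is read by [h]. Other terms go to [c0]. *)
Fixpoint interp (t : term T X) : C :=
  match t with
  | Var _ => c0
  | App f ts =>
    match pselect (depth f = 0) with
    | left e => act (cls_op P (fun i => interp (ts i)) e)
    | right _ =>
      match pselect (depth f = 1), pselect (forall i, uniform (ts i) n) with
      | left e, left us => h (cls_op P (fun i => cls P (us i)) e)
      | _, _ => c0
      end
    end
  end.

Lemma interp_app0 f ts (e : depth f = 0) :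
  interp (App f ts) = act (cls_op P (fun i => interp (ts i)) e).
Proof.
by rewrite /=; case: pselect => // e'; congr act; exact: cls_ext.
Qed.

Lemma interp_app1 f ts (e : depth f = 1) (us : forall i, uniform (ts i) n) :
  interp (App f ts) = h (cls_op P (fun i => cls P (us i)) e).
Proof.
rewrite /=; case: pselect => [e0|_]; first by exfalso; rewrite e0 in e.
case: pselect => // e'; case: pselect => // us'; congr (h _).
apply: cls_ext; congr App; apply/funext => i.
by congr Var; exact: cls_ext.
Qed.

(** Operations of depth 0 act through the structure of [C], so a depth-0 context is evaluated in
    [C]. *)
Lemma interp_subst0 (V : Sets) (s : V -> term T X) (t : term T V)
  (ut : uniform t 0) :
  interp (subst s t) = act (fmap (M 0) (fun v => interp (s v)) (cls P ut)).
Proof.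
elim: t ut => [v|f ts IH] ut.
  rewrite (cls_ext P ut (uniform_var T v) erefl) cls_var.
  by rewrite -eta_natural act_eta.
have [k /esym/eqP] := uniform_inv ut.
rewrite addn_eq0 => /andP[/eqP-> /eqP e] us.
rewrite (cls_app (k := 0) P e us) mu00_natural act_mu !cls_op_fmap.
rewrite [LHS](interp_app0 _ e); congr (act (cls_op _ _ _)).
by apply/funext => i; exact: IH.
Qed.

(** Outer operations of depth 0 pass through the homomorphism [h]; below an operation of depth 1
    only terms of depth 0 remain. *)
Lemma interp_subst1 (V : Sets) (s : V -> term T X)
  (us : forall v, uniform (s v) n) (t : term T V) (ut : uniform t 1) :
  interp (subst s t) = h (fmap (M 1) (fun v => cls P (us v)) (cls P ut)).
Proof.
elim: t ut => [v|f ts IH] ut; first by have := uniform_inv ut.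
have [k ek uts] := uniform_inv ut.
case ef: (depth f) ek => [|d] ek.
  rewrite addn0 in ek; rewrite -ek in uts.
  rewrite (cls_app (k := 1) P ef uts).
  rewrite [fmap _ _ _](fmap1_act _ (X := V)) cls_op_fmap.
  rewrite [RHS](hom_act h) cls_op_fmap [LHS](interp_app0 _ ef).
  by congr (act (cls_op _ _ _)); apply/funext => i; exact: IH.
move: ek; rewrite addnS => -[] /esym/eqP; rewrite addn_eq0.
move=> /andP[/eqP k0 /eqP d0]; rewrite k0 in uts; rewrite d0 in ef.
rewrite (cls_app (k := 0) P ef uts) mu10_natural cls_op_fmap.
(* By [h_coeq], the depth-0 arguments may be evaluated in the algebra [M n X]. *)
rewrite [RHS](h_coeq _) /= cls_op_fmap.
pose uss i := uniform_subst (uts i) us.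
rewrite [LHS](interp_app1 ef uss); congr (h (cls_op _ _ _)).
by apply/funext => i; rewrite cls_mu.
Qed.

(** Soundness, by induction on derivations; the grade is a variable [m] to allow this induction. *)
Lemma interp_derivable m (t u : term T X) :
  derivable m t u -> m = n.+1 -> interp t = interp u.
Proof.
have [op_le1 ax_le1] := T_depth1.
elim=> {m t u} [|||f ss ts k dst IH|e k s ax us].
- by [].
- by move=> m t u _ IH /IH.
- by move=> m t u v _ IH1 _ IH2 em; rewrite IH1 ?IH2.
- have := op_le1 f; rewrite leq_eqVlt ltnS leqn0 => /orP[/eqP e|/eqP e] ek.
  + have kn : k = n by apply: succn_inj; rewrite -ek e addn1.
    have uS i : uniform (ss i) n.
      by rewrite -kn; case: (derivable_uniform (dst i)).
    have uT i : uniform (ts i) n.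
      by rewrite -kn; case: (derivable_uniform (dst i)).
    rewrite (interp_app1 e uS) (interp_app1 e uT); congr (h (cls_op _ _ _)).
    by apply/funext => i; apply/cls_eqP; rewrite -kn.
  + rewrite !(interp_app0 _ e); congr (act (cls_op _ _ _)).
    by apply/funext => i; apply: IH; rewrite -ek e addn0.
(* An axiom of depth 0 is instantiated with terms of depth [n.+1], one of depth 1 with terms of
   depth [n]. *)
- case: e ax s us => V [|[|d]] l r ul ur ax s us ek.
  + rewrite (interp_subst0 s ul) (interp_subst0 s ur).
    congr (act (fmap _ _ _)); apply/cls_eqP.
    exact: derivable_ax ax.
  + have kn : k = n by case: ek.
    rewrite kn in us.
    rewrite (interp_subst1 us ul) (interp_subst1 us ur).
    congr (h (fmap _ _ _)); apply/cls_eqP.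
    exact: derivable_ax ax.
  + by have := ax_le1 _ ax.
Qed.

End Interpretation.

(** Substituting representatives into depth-1 terms for [t] and [u] gives terms of depth [n.+1].
    Equal flattenings make these derivably equal, and soundness gives [h t = h u]. *)
Lemma Mbar1_quo_eq (M : graded_monad) (n : nat) (X : Sets)
  (t u : M 1 (M n X)) :
  depth1 M -> mu M 1 n t = mu M 1 n u ->
  Mbar1_quo (gm_alg M n X) t = Mbar1_quo (gm_alg M n X) u.
Proof.
move=> /depth1_presentation[T dT [P]] tu; apply/coeq_classP => C h hfg.
pose s (v : M n X) := projT1 (cid (cls_surj P v)).
pose us v : uniform (s v) n := projT1 (cid (projT2 (cid (cls_surj P v)))).
have sK v : cls P (us v) = v := projT2 (cid (projT2 (cid (cls_surj P v)))).
have muE w (uw : uniform w 1) :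
    mu M 1 n (cls P uw) = cls P (uniform_subst uw us).
  rewrite -cls_mu -[in LHS](fmap_id (cls P uw)); congr (mu _ _ _ (fmap _ _ _)).
  by apply/funext => v; rewrite sK.
(* [h t] only supplies the default value that [interp] requires in [C]. *)
have hE w (uw : uniform w 1) : interp P h (h t) (subst s w) = h (cls P uw).
  rewrite (interp_subst1 P hfg _ us uw) -[in RHS](fmap_id (cls P uw)).
  by congr (h (fmap _ _ _)); apply/funext => v; rewrite sK.
case: (cls_surj P t) => w [uw tE]; case: (cls_surj P u) => w' [uw' uE].
rewrite -tE -uE !muE in tu *; rewrite -!hE.
by move/cls_eqP: tu => tu; exact: (interp_derivable P dT hfg _ tu).
Qed.

(** * Free algebras and monomorphisms *)

Lemma act_hom_act (M : graded_monad) (A : alg M) (X : Sets) (f : X -> A)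
  (t : M 0 (gm_alg M 0 X)) :
  act (fmap (M 0) f (act t)) =
  act (fmap (M 0) (fun u => act (fmap (M 0) f u)) t).
Proof. by rewrite mu00_natural act_mu -!fmap_comp. Qed.

Definition act_hom (M : graded_monad) (A : alg M) (X : Sets) (f : X -> A) :
  hom (gm_alg M 0 X) A := Hom (act_hom_act f).

(** Elements of [A] are homomorphisms from the free algebra on one generator. *)
Lemma mono_inj (M : graded_monad) (A B : alg M) (m : hom A B) :
  mono m -> injective m.
Proof.
move=> mm x y mxy.
have muv : m \o act_hom (fun _ : unit => x) =1 m \o act_hom (fun=> y).
  move=> t /=; rewrite !hom_act -!fmap_comp.
  by congr (act (fmap _ _ _)); apply/funext.
by have := mm _ _ _ muv (eta M tt); rewrite /= -!eta_natural !act_eta.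
Qed.

Lemma inj_mono (M : graded_monad) (A B : alg M) (m : hom A B) :
  injective m -> mono m.
Proof. by move=> mi C u v muv x; apply: mi; exact: muv. Qed.

Lemma Mbar1_map_ext (M : graded_monad) (A B : alg M) (f g : hom A B) :
  f =1 g -> Mbar1_map f =1 Mbar1_map g.
Proof.
move=> /funext fg q; rewrite -[q]coeq_reprK.
by rewrite [LHS]Mbar1_mapE [RHS]Mbar1_mapE /= fg.
Qed.

(** * Behaviour after one more step *)

Section GradedSemantics.
Variables (G : functor) (S : graded_semantics G) (X : Sets) (gamma : X -> G X).

Local Notation obs n := (star (n := 0) (gamma_iter S gamma n)).
Local Notation one_step := (star (n := 0) (fun x => gs_alpha S (gamma x))).

(** Links the winning condition at the end of a play to depth-0 behaviour. *)
Lemma obs0 s : obs 0 s = fmap (S 0) (fun=> tt) s.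
Proof.
rewrite /star /=.
rewrite (_ : (fun x => _) = fmap (S 0) (fun=> tt) \o @eta S X) //.
by rewrite fmap_comp mu_natural -[in RHS](mu_fmap_eta s) eq_axiomK.
Qed.

Lemma obsS n s :
  obs n.+1 s = mu S 1 n (fmap (S 1) (gamma_iter S gamma n) (one_step s)).
Proof.
rewrite /star [fmap (S 1) _ _](fmap1_act _ (X := X)) gm_assoc0.
by rewrite -!fmap_comp.
Qed.

Lemma Mbar1_obs n s :
  Mbar1_map (star0 (gamma_iter S gamma n)) (Mbar1_free s) =
  Mbar1_quo (gm_alg S n unit) (fmap (S 1) (gamma_iter S gamma n) s).
Proof.
rewrite [LHS]Mbar1_mapE /= -fmap_comp.
congr (coeq_class _ _ _); congr (fmap _ _ _).
apply/funext => x /=.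
by rewrite /star -eta_natural mu_eta.
Qed.

Lemma mu1_coeq n :
  @mu S 1 n unit \o mu10 S (S n unit) =1
  @mu S 1 n unit \o fmap1 S (@act S (gm_alg S n unit)).
Proof. by move=> t /=; have := mu_assoc t; rewrite eq_axiomK => <-. Qed.

Fact mu1_act n (t : S 0 (gm_alg S 1 (S n unit))) :
  mu S 1 n (act t) = act (fmap (S 0) (mu S 1 n) t : S 0 (gm_alg S n.+1 unit)).
Proof. exact: gm_assoc0. Qed.

Definition mu1 n : hom (gm_alg S 1 (S n unit)) (gm_alg S n.+1 unit) :=
  @Hom S (gm_alg S 1 (S n unit)) (gm_alg S n.+1 unit) (mu S 1 n) (@mu1_act n).

(** Forwards, [mu1 n] factors through the coequalizer; backwards, depth 1 is used. *)
Lemma mu1_quo n t u :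
  Mbar1_quo (gm_alg S n unit) t = Mbar1_quo (gm_alg S n unit) u <->
  mu S 1 n t = mu S 1 n u.
Proof.
split; last by apply: Mbar1_quo_eq; exact: gs_depth1.
by move/coeq_classP => /(_ _ (mu1 n)); apply; exact: mu1_coeq.
Qed.

Lemma obsS_eq n s t :
  obs n.+1 s = obs n.+1 t <->
  Mbar1_map (star0 (gamma_iter S gamma n)) (Mbar1_free (one_step s)) =
  Mbar1_map (star0 (gamma_iter S gamma n)) (Mbar1_free (one_step t)).
Proof. by rewrite !obsS !Mbar1_obs mu1_quo. Qed.

(** * Moves contained in the kernel *)

Section Factor.
Variables (n : nat) (Z : config_rel S X).
Hypothesis Z_obs : forall c, Z c -> obs n c.1 = obs n c.2.

Lemma obs_coeq :
  star0 (gamma_iter S gamma n) \o star0 (@ellZ _ _ _ Z) =1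
  star0 (gamma_iter S gamma n) \o star0 (@rZ _ _ _ Z).
Proof.
move=> t; rewrite /= /star !mu00_natural.
rewrite !gm_assoc0 -!fmap_comp; congr (mu S 0 (0 + n) _).
congr (fmap (S 0) _ t); apply/funext => -[c Zc]; exact: Z_obs.
Qed.

Definition obs_desc : hom (CZ Z) (gm_alg S n unit) := coeq_desc obs_coeq.

Lemma obs_descE s : obs_desc (cZ Z s) = obs n s.
Proof. exact: (coeq_descE obs_coeq). Qed.

Lemma Mbar1_obs_desc s :
  Mbar1_map obs_desc (Zbar gamma Z s) =
  Mbar1_map (star0 (gamma_iter S gamma n)) (Mbar1_free (one_step s)).
Proof.
rewrite /Zbar -[LHS]Mbar1_map_comp.
by apply: Mbar1_map_ext => x; exact: obs_descE.
Qed.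

Lemma obsS_admissible s t :
  admissible gamma Z (s, t) -> obs n.+1 s = obs n.+1 t.
Proof. by move=> adm; apply/obsS_eq; rewrite -!Mbar1_obs_desc adm. Qed.

End Factor.

(** * The kernel as a move *)

Definition obs_ker n : config_rel S X := fun c => obs n c.1 = obs n c.2.

Lemma obs_desc_inj n :
  injective (obs_desc (n := n) (Z := obs_ker n) (fun=> id)).
Proof.
move=> p q; rewrite -[p]coeq_reprK -[q]coeq_reprK.
set x := coeq_repr p; set y := coeq_repr q => xy.
have Zxy : obs_ker n (x, y) by rewrite /obs_ker /= -!(obs_descE (fun=> id)).
(* The pair [(x, y)] lies in the relation, so the generator it yields forces its two components to
   be identified. *)
have := coeq_mapE (star0 (@ellZ _ _ _ (obs_ker n)))
  (star0 (@rZ _ _ _ (obs_ker n))) (eta S (exist _ (x, y) Zxy)).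
by rewrite /= /star -!eta_natural !mu_eta.
Qed.

(** Preservation of monomorphisms keeps [obs_desc] injective under [Mbar1_map], so it can be
    cancelled. *)
Lemma admissible_obs_ker n s t : Mbar1_preserves_mono S ->
  obs n.+1 s = obs n.+1 t -> admissible gamma (obs_ker n) (s, t).
Proof.
move=> HM /obsS_eq; rewrite -!(Mbar1_obs_desc (Z := obs_ker n) (fun=> id)).
by apply: mono_inj; apply/HM/inj_mono/obs_desc_inj.
Qed.

(** * Strategies and the game *)

Lemma duplicator_winsS n c : duplicator_wins S gamma n.+1 c ->
  exists2 Z, admissible gamma Z c &
    forall c', Z c' -> duplicator_wins S gamma n c'.
Proof.
case=> sigma win; exists (sigma [::] c).
  by case: (win [::] c (play_start _ _)) => /(_ isT).
(* The residual strategy prepends [c] to the history, so its plays extend to plays of [sigma] from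
   [c]. *)
move=> c' Zc'; exists (fun h => sigma (c :: h)) => h d pl.
have {pl} : play sigma c (c :: h) d.
  elim: pl => [|{}h {}d d' _ IH sd]; last exact: (play_round IH).
  exact: (play_round (play_start _ _) Zc').
by move=> /win[adm fin]; split=> [hn|hn]; [exact: adm|apply: fin; rewrite /= hn].
Qed.

End GradedSemantics.

Theorem theorem6p6 (G : functor) (S : graded_semantics G)
    (HM : Mbar1_preserves_mono S)
    (X : Sets) (gamma : X -> G X) (n : nat) (s t : S 0 X) :
  duplicator_wins S gamma n (s, t) <->
  star (n := 0) (gamma_iter S gamma n) s = star (n := 0) (gamma_iter S gamma n) t.
Proof.
split=> [|st].
  elim: n s t => [|n IH] s t.
    by case=> sigma /(_ _ _ (play_start _ _))[_ /(_ erefl)]; rewrite !obs0.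
  move=> /duplicator_winsS[Z adm win].
  by apply: (obsS_admissible _ adm) => -[s' t'] /win /IH.
(* The current round leaves [n - (size h).+1] rounds after it; the kernel for that number is
   played. *)
exists (fun h _ => obs_ker gamma (n - (size h).+1)) => h c pl.
(* Invariant: the two states agree on the behaviour for the rounds still to come. *)
have : size h <= n -> obs_ker gamma (n - size h) c.
  elim: pl => [|{}h {}c c' _ _ Zc' _]; first by rewrite subn0.
  by rewrite size_rcons.
case: c {pl} => x y obs_xy; split=> [hn|hn].
  apply: admissible_obs_ker => //.
  by rewrite -subSn // subSS; exact: obs_xy (ltnW hn).
by have := obs_xy; rewrite hn subnn /obs_ker !obs0; apply.
Qed.
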